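(* Let $X$ be a completely regular space. Let $H$ be a non-vanishing closed ideal in $C_B(X)$. The following are equivalent: (1) $\mathfrak{sp}(H)$ is paracompact. (2) $H$ is representable as $H=\overline{\bigoplus_{i\in I}\langle h_i\rangle}$ for some indexed family $\{h_i:i\in I\}$ of elements of $C_B(X)$. Here the bar denotes the closure in $C_B(X)$.
   Context: Completely regular spaces are assumed Hausdorff. The scalar field $\mathbb{F}$ is fixed and is $\mathbb{R}$ or $\mathbb{C}$. $C_B(X)$ is the Banach algebra of all bounded continuous mappings $X\to\mathbb{F}$ with pointwise addition and multiplication and the supremum norm. $\beta X$ is the Stone–Čech compactification of $X$ (containing $X$ as a dense subspace), and for $f\in C_B(X)$, $f_\beta:\beta X\to\mathbb{F}$ is its unique continuous extension. For $f:Y\to\mathbb{F}$, $\mathrm{coz}(f)=\{y\in Y:f(y)\neq0\}$. An ideal $H$ of $C_B(X)$ is non-vanishing if for every $x\in X$ there is $h\in H$ with $h(x)\neq0$. For a non-vanishing closed ideal $H$ of $C_B(X)$, its spectrum is the subspace $\mathfrak{sp}(H)=\bigcup_{h\in H}\mathrm{coz}(h_\beta)$ of $\beta X$. $\langle h\rangle$ is the ideal of $C_B(X)$ generated by $h$. For ideals $G_i$ of $C_B(X)$, $\bigoplus_{i\in I}G_i$ denotes the internal algebraic direct sum: the sum $\sum_{i\in I}G_i$ (all finite sums of elements of the $G_i$), under the requirement that $G_{i_0}\cap\sum_{i_0\neq i\in I}G_i=0$ for every $i_0\in I$. A Hausdorff space is paracompact if every open cover of it has a locally finite open refinement. *)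

(* Defs.v *)
From HB Require Import structures.
From mathcomp Require Import all_boot all_order all_algebra.
From mathcomp Require Import all_classical all_reals all_analysis.
From mathcomp Require Import complex.

Set Implicit Arguments.
Unset Strict Implicit.
Unset Printing Implicit Defensive.

Import Order.TTheory GRing.Theory Num.Theory.
Import numFieldNormedType.Exports.

Local Open Scope classical_set_scope.
Local Open Scope ring_scope.

Variant scalar_kind := RealScalars | ComplexScalars.

Definition scalar (R : realType) (k : scalar_kind) : numFieldType :=
  match k with RealScalars => R | ComplexScalars => R[i] end.

(* The norm of a numFieldType takes its values in the field itself;
   [modulus] is that norm with values in [R], where suprema exist, and
   [of_real] is the inclusion of [R] in the scalar field. *)
Definition modulus (R : realType) (k : scalar_kind) : scalar R k -> R :=
  match k return scalar R k -> R with
  | RealScalars => fun x => `|x|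
  | ComplexScalars => fun z => complex.Re `|z|
  end.

Definition of_real (R : realType) (k : scalar_kind) : R -> scalar R k :=
  match k return R -> scalar R k with
  | RealScalars => fun x => x
  | ComplexScalars => fun x => x%:C%C
  end.

Section scalar_theory.
Context (R : realType) (k : scalar_kind).
Implicit Types (x y : scalar R k) (a b : R).

Lemma of_real_modulus x : of_real k (modulus x) = `|x|.
Proof.
by case: k x => //= x; apply/eqP; rewrite eq_complex /= !eqxx.
Qed.

Lemma of_realD a b : of_real k (a + b) = of_real k a + of_real k b.
Proof. by case: k => //=; rewrite rmorphD. Qed.

Lemma of_realM a b : of_real k (a * b) = of_real k a * of_real k b.
Proof. by case: k => //=; rewrite rmorphM. Qed.

Lemma of_real0 : of_real k 0 = 0 :> scalar R k.
Proof. by case: k => //=; rewrite rmorph0. Qed.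

Lemma of_real1 : of_real k 1 = 1 :> scalar R k.
Proof. by case: k => //=; rewrite rmorph1. Qed.

Lemma ler_of_real a b : (of_real k a <= of_real k b) = (a <= b).
Proof. by case: k => //=; rewrite lecR. Qed.

Lemma of_real_inj : injective (of_real k : R -> scalar R k).
Proof. by move=> a b e; apply/le_anti; rewrite -!ler_of_real e lexx. Qed.

Lemma modulus_ge0 x : 0 <= modulus x.
Proof. by rewrite -ler_of_real of_real_modulus of_real0. Qed.

Lemma modulusD x y : modulus (x + y) <= modulus x + modulus y.
Proof. by rewrite -ler_of_real of_realD !of_real_modulus ler_normD. Qed.

Lemma modulusM x y : modulus (x * y) = modulus x * modulus y.
Proof. by apply: of_real_inj; rewrite of_realM !of_real_modulus normrM. Qed.

Lemma modulus0_eq0 x : modulus x = 0 -> x = 0.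
Proof.
by move=> x0; apply/normr0_eq0; rewrite -of_real_modulus x0 of_real0.
Qed.

End scalar_theory.

Section bounded_continuous.
Context (R : realType) (k : scalar_kind) (X : topologicalType).
Local Notation F := (scalar R k).

Definition bounded_continuous : {pred X -> F} :=
  mem [set f : X -> F | continuous f /\ bounded_fun f].

Record CB := MkCB {
  CB_fun :> X -> F;
  CB_subproof : CB_fun \in bounded_continuous }.

HB.instance Definition _ := [isSub for CB_fun].
HB.instance Definition _ := [Choice of CB by <:].

Lemma bounded_funE (f : X -> F) :
  bounded_fun f <-> exists M : R, forall x, modulus (f x) <= M.
Proof.
split=> [|[M fM]].
  case=> M [Mreal fM]; exists (modulus (M + 1)) => x.
  rewrite -(ler_of_real k) !of_real_modulus.
  apply: (le_trans (fM (M + 1) _ x I)); first by rewrite ltrDl ltr01.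
  by apply: real_ler_norm; rewrite realD ?real1.
exists (of_real k M); split.
  by rewrite realE -(of_real0 R k) !ler_of_real -realE num_real.
move=> N MN x _; rewrite /= -of_real_modulus (le_trans _ (ltW MN))//.
by rewrite ler_of_real.
Qed.

Lemma bounded_continuousP (f : X -> F) :
  reflect (continuous f /\ exists M : R, forall x, modulus (f x) <= M)
          (f \in bounded_continuous).
Proof.
apply: (iffP idP); rewrite inE /=.
  by case=> cf /bounded_funE.
by case=> cf /bounded_funE.
Qed.

Lemma bounded_continuous_subring : subring_closed bounded_continuous.
Proof.
split=> [|f g|f g].
- apply/bounded_continuousP; split; first exact: cst_continuous.
  by exists (modulus (1 : F)).
- move=> /bounded_continuousP[cf [M fM]] /bounded_continuousP[cg [N gN]].
  apply/bounded_continuousP; split.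
    by move=> x; apply: continuousB; [exact: cf|exact: cg].
  exists (M + N) => x; rewrite -(ler_of_real k) of_real_modulus of_realD.
  by rewrite (le_trans (ler_normB _ _))// lerD// -of_real_modulus ler_of_real.
- move=> /bounded_continuousP[cf [M fM]] /bounded_continuousP[cg [N gN]].
  apply/bounded_continuousP; split.
    by move=> x; apply: continuousM; [exact: cf|exact: cg].
  by exists (M * N) => x; rewrite modulusM ler_pM// modulus_ge0.
Qed.

HB.instance Definition _ := GRing.isSubringClosed.Build (X -> F)
  bounded_continuous bounded_continuous_subring.

Lemma bounded_continuousZ : GRing.scaler_closed bounded_continuous.
Proof.
move=> l f /bounded_continuousP[cf [M fM]].
apply/bounded_continuousP; split.
  by move=> x; apply: continuousM; [exact: cst_continuous|exact: cf].
by exists (modulus l * M) => x; rewrite modulusM ler_wpM2l// modulus_ge0.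
Qed.

HB.instance Definition _ := GRing.isScaleClosed.Build F (X -> F)
  bounded_continuous bounded_continuousZ.

HB.instance Definition _ := GRing.SubChoice_isSubComPzRing.Build _ _ CB
  (subringClosedP bounded_continuous).
HB.instance Definition _ := [SubZmodule_isSubLmodule of CB by <:].

Lemma CB_continuous (f : CB) : continuous f.
Proof. by have /bounded_continuousP[] := CB_subproof f. Qed.

Lemma CB_bounded (f : CB) : exists M : R, forall x, modulus (f x) <= M.
Proof. by have /bounded_continuousP[] := CB_subproof f. Qed.

Definition supnorm (f : CB) : R := sup (range (fun x => modulus (f x))).

Lemma supnorm_ub (f : CB) x : modulus (f x) <= supnorm f.
Proof.
apply: ub_le_sup; last by exists x.
by have [M fM] := CB_bounded f; exists M => _ [y _ <-].
Qed.

Lemma supnorm_le (f : CB) (M : R) :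
  0 <= M -> (forall x, modulus (f x) <= M) -> supnorm f <= M.
Proof.
move=> M0 fM.
have [E|/set0P ne] := eqVneq (range (fun x => modulus (f x))) set0.
  by rewrite /supnorm E sup0.
by apply: ge_sup => // _ [x _ <-].
Qed.

Lemma supnorm_ge0 (f : CB) : 0 <= supnorm f.
Proof.
have [E|/set0P[_ [x _ _]]] := eqVneq (range (fun x => modulus (f x))) set0.
  by rewrite /supnorm E sup0.
exact: le_trans (modulus_ge0 (f x)) (supnorm_ub f x).
Qed.

Lemma CB_normD (f g : CB) :
  of_real k (supnorm (f + g)) <= of_real k (supnorm f) + of_real k (supnorm g).
Proof.
rewrite -of_realD ler_of_real supnorm_le ?addr_ge0 ?supnorm_ge0// => x.
by rewrite (le_trans (modulusD _ _))// lerD// supnorm_ub.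
Qed.

Lemma CB_normZ (l : F) (f : CB) :
  of_real k (supnorm (l *: f)) = `|l| * of_real k (supnorm f).
Proof.
rewrite -of_real_modulus -of_realM; congr of_real; apply/le_anti/andP; split.
  apply: supnorm_le => [|x].
    by rewrite mulr_ge0 ?modulus_ge0 ?supnorm_ge0.
  by rewrite modulusM ler_wpM2l ?modulus_ge0 ?supnorm_ub.
have [->|l0] := eqVneq (modulus l) 0; first by rewrite mul0r supnorm_ge0.
have lgt0 : 0 < modulus l by rewrite lt0r l0 modulus_ge0.
rewrite mulrC -ler_pdivlMr//; apply: supnorm_le => [|x].
  by rewrite divr_ge0 ?modulus_ge0 ?supnorm_ge0.
by rewrite ler_pdivlMr// mulrC -modulusM (supnorm_ub (l *: f)).
Qed.

Lemma CB_norm0_eq0 (f : CB) : of_real k (supnorm f) = 0 -> f = 0.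
Proof.
rewrite -(of_real0 R k) => /of_real_inj f0; apply/val_inj/funext => x.
by apply/modulus0_eq0/le_anti; rewrite modulus_ge0 andbT -f0 supnorm_ub.
Qed.

HB.instance Definition _ := Lmodule_isNormed.Build F CB
  CB_normD CB_normZ CB_norm0_eq0.

Lemma CB_normE (f : CB) : `|f| = of_real k (supnorm f).
Proof. by []. Qed.

Lemma CB_closureP (A : set CB) (f : CB) :
  closure A f <->
  forall e : R, 0 < e -> exists2 g, A g & supnorm (f - g) < e.
Proof.
have lt_of_real a b : (of_real k a < of_real k b) = (a < b).
  by rewrite !lt_neqAle ler_of_real (inj_eq (@of_real_inj _ _)).
split=> [clf e e0|clf B /nbhs_ballP[e /= e0 eB]].
  have [|g [Ag]] := clf (ball f (of_real k e)).
    by apply: nbhsx_ballx; rewrite -(of_real0 R k) lt_of_real.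
  by rewrite -ball_normE /ball_ /= CB_normE lt_of_real; exists g.
have eE : of_real k (modulus e) = e by rewrite of_real_modulus gtr0_norm.
have [|g Ag fg] := clf (modulus e).
  by rewrite -lt_of_real eE of_real0.
exists g; split=> //; apply: eB.
by rewrite -ball_normE /ball_ /= CB_normE -eE lt_of_real.
Qed.

End bounded_continuous.

Section ideals.
Context {A : comPzRingType}.

(* Not required to be proper, contrary to the ideals of ring_quotient. *)
Definition is_ideal (H : set A) :=
  [/\ H 0, forall f g, H f -> H g -> H (f + g) & forall a f, H f -> H (a * f)].

Definition principal_ideal (h : A) : set A := smallest is_ideal [set h].

Definition ideal_sum (I : choiceType) (J : set I) (G : I -> set A) : set A :=
  [set f | exists (D : set I) (g : I -> A),
    [/\ finite_set D, D `<=` J, forall i, D i -> G i (g i)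
      & f = \sum_(i \in D) g i]].

Definition ideal_sum_direct (I : choiceType) (G : I -> set A) :=
  forall i0, G i0 `&` ideal_sum [set~ i0] G = [set 0].

Lemma principal_idealE (h : A) : principal_ideal h = range (fun a => a * h).
Proof.
apply/seteqP; split=> [f|_ [a _ <-] H [[_ _ HM] Hh]]; last exact/HM/Hh.
apply; split=> [|_ ->]; last by exists 1; rewrite ?mul1r.
split=> [|_ _ [a _ <-] [b _ <-]|a _ [b _ <-]].
- by exists 0; rewrite ?mul0r.
- by exists (a + b); rewrite ?mulrDl.
- by exists (a * b); rewrite ?mulrA.
Qed.

End ideals.

Section paracompactness.
Context {T : topologicalType}.

Definition open_cover (U : set (set T)) :=
  U `<=` open /\ \bigcup_(A in U) A = setT.

Definition refines (V U : set (set T)) :=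
  forall B, V B -> exists2 A, U A & B `<=` A.

Definition locally_finite (V : set (set T)) :=
  forall x : T, exists2 N, nbhs x N &
    finite_set [set B | V B /\ B `&` N !=set0].

End paracompactness.

Definition paracompact (T : topologicalType) :=
  hausdorff_space T /\
  forall U : set (set T), open_cover U ->
    exists V, [/\ open_cover V, refines V U & locally_finite V].

(* The Stone-Cech compactification is the closure of the image of X in the cube
   [0,1]^C(X,[0,1]), the latter seen in R^C(X,[0,1]). X is identified with a
   dense subspace of it, by [to_stone_cech_dense], [to_stone_cech_continuous],
   [to_stone_cech_inj] and [to_stone_cech_embedding]. *)
Section stone_cech.
Context (R : realType) (X : topologicalType).

Definition unit_continuous : set (X -> R) :=
  [set f : X -> R | continuous f /\ forall x, 0 <= f x <= 1].

Definition evaluation (x : X) : {ptws unit_continuous -> R} :=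
  fun f => set_val f x.

Definition stone_cech : topologicalType := closure (range evaluation).

Lemma evaluation_closure x : evaluation x \in closure (range evaluation).
Proof. by rewrite inE; apply: subset_closure; exists x. Qed.

Definition to_stone_cech (x : X) : stone_cech :=
  exist _ (evaluation x) (evaluation_closure x).

Lemma stone_cech_proj_continuous (f : unit_continuous) :
  continuous (fun p : stone_cech => set_val p f).
Proof.
move=> p; apply: (@continuous_comp stone_cech {ptws unit_continuous -> R} R
  set_val (proj f)).
  exact: initial_continuous.
exact: proj_continuous.
Qed.

Lemma stone_cech_hausdorff : hausdorff_space stone_cech.
Proof.
move=> p q pq; apply/val_inj/funext => f.
apply: (@Rhausdorff R) => A B pA qB.
have [r [rA rB]] := pq _ _ (@stone_cech_proj_continuous f p A pA)
                            (@stone_cech_proj_continuous f q B qB).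
by exists (set_val r f).
Qed.

Let cube : set {ptws unit_continuous -> R} :=
  [set p | forall f, `[0, 1]%classic (p f)].

Lemma stone_cech_compact : compact [set: stone_cech].
Proof.
have cube_compact : compact cube.
  apply: (@tychonoff unit_continuous (fun=> R) (fun=> `[0, 1]%classic)) => f.
  exact: segment_compact.
have hd : hausdorff_space {ptws unit_continuous -> R}.
  apply: (@hausdorff_product unit_continuous (fun=> R)) => f.
  exact: Rhausdorff.
have sub : closure (range evaluation) `<=` cube.
  rewrite closureE; apply: smallest_sub.
    exact: compact_closed.
  move=> _ [x _ <-] f; rewrite /= in_itv/=.
  by have /set_mem[_] := valP f; apply.
have cl_compact : compact (closure (range evaluation)).
  by apply: subclosed_compact cube_compact sub; exact: closed_closure.
move=> F FF _.
have [|p [clp Fp]] := cl_compact (set_val @ F) _.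
  by apply: (@filterS _ F _ setT _ _ filterT) => q _; exact: set_mem (valP q).
exists (exist _ p (mem_set clp)); split=> // A B FA [_ [[W oW <-] /= Wp] WB].
have [_ [[q Aq <-] Wq]] : set_val @` A `&` W !=set0.
  apply: Fp; last exact: open_nbhs_nbhs.
  by apply: (@filterS _ F _ A _ _ FA) => q Aq; exists q.
by exists q; split; last exact: WB.
Qed.

Lemma to_stone_cech_continuous : continuous to_stone_cech.
Proof.
have cev : continuous evaluation.
  move=> x; apply/cvg_sup => f; move: x.
  apply/(@continuousP _ (initial_topology (@^~ f))) => A [B oB <-].
  have [/continuousP cf _] : unit_continuous (set_val f) := set_mem (valP f).
  exact: cf.
by apply/continuousP => _ [W oW <-]; move/continuousP : cev; exact.
Qed.

Lemma to_stone_cech_dense : dense (range to_stone_cech).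
Proof.
move=> O [p Op] [W oW WO]; rewrite -WO in Op.
have /set_mem clp := valP p.
have [_ [[x _ <-] Wx]] := clp _ (open_nbhs_nbhs (conj oW Op)).
by exists (to_stone_cech x); split; [rewrite -WO|exists x].
Qed.

Lemma unit_continuous_separator (x : X) (B : set X) :
  completely_regular_space X -> closed B -> ~ B x ->
  exists f : unit_continuous,
    set_val f x = 0 /\ forall y, B y -> set_val f y = 1.
Proof.
move=> cr cB Bx.
have /(@uniform_separatorP _ R)[f [cf f01 fx fB]] := cr x B cB Bx.
have uf : f \in unit_continuous.
  rewrite inE; split => // y; have := f01 (f y) (ex_intro2 _ _ y I erefl).
  by rewrite /= in_itv.
exists (exist (fun w => w \in unit_continuous) f uf); split=> [|y By].
  by apply: fx; exists x.
by apply: fB; exists y.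
Qed.

Lemma to_stone_cech_embedding (U : set X) : completely_regular_space X ->
  open U -> exists2 V : set stone_cech, open V & U = to_stone_cech @^-1` V.
Proof.
move=> cr oU.
exists (\bigcup_(f in [set f : unit_continuous |
                         set_val f @^-1` `]-oo, 1[ `<=` U])
          [set p : stone_cech | set_val p f < 1]).
  apply: bigcup_open => f _.
  have /continuousP/(_ [set x | x < 1]) := @stone_cech_proj_continuous f.
  by apply; exact: open_lt.
apply/seteqP; split=> x /=; last first.
  by case=> f fU /= fx; apply: fU; rewrite /= in_itv.
move=> Ux.
have [//|f [fx fU]] := unit_continuous_separator cr (open_closedC oU) (x := x).
exists f; last exact: (eq_ind_r (fun z : R => z < 1) ltr01 fx).
move=> y /=; rewrite in_itv/= => fy; apply: contrapT => /fU fy1.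
by rewrite fy1 ltxx in fy.
Qed.

Lemma to_stone_cech_inj : completely_regular_space X -> hausdorff_space X ->
  injective to_stone_cech.
Proof.
move=> cr T2 x y xy; apply: T2 => A B; rewrite nbhsE => -[A' [oA' A'x] A'A] By.
have [V _ A'E] := to_stone_cech_embedding cr oA'.
exists y; split; last exact: nbhs_singleton.
by apply: A'A; move: A'x; rewrite A'E /= xy.
Qed.

End stone_cech.
Arguments to_stone_cech {R X} x.

Definition coz (Y : Type) (F : nmodType) (f : Y -> F) : set Y :=
  [set y | f y != 0].

Section stone_extension.
Context {R : realType} {k : scalar_kind} {X : topologicalType}.

(* The default value of [xget] is never used, by [stone_ext_exists]; the choice
   is unique, by [stone_ext_unique]. *)
Definition stone_ext (f : CB R k X) : stone_cech R X -> scalar R k :=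
  xget (fun=> 0) [set g | continuous g /\ forall x, g (to_stone_cech x) = f x].

Lemma stone_ext_exists (f : CB R k X) :
  exists g : stone_cech R X -> scalar R k,
    continuous g /\ forall x, g (to_stone_cech x) = f x.
Proof.
have ext (u : X -> R) (M : R) : continuous u -> (forall x, `|u x| <= M) ->
    exists g : stone_cech R X -> R,
      continuous g /\ forall x, g (to_stone_cech x) = u x.
  move=> cu uM; pose N : R := `|M| + 1; have N0 : 0 < N by rewrite ltr_wpDl.
  have uN x : `|u x| <= N.
    by rewrite (le_trans (uM x))// (le_trans (ler_norm M))// lerDl.
  have uv : (fun x => (u x + N) / (N + N)) \in @unit_continuous R X.
    rewrite inE; split=> x.
      apply: cvgM; last exact: cvg_cst.
      by apply: cvgD; [exact: cu|exact: cvg_cst].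
    have [ge le] : 0 <= u x + N /\ u x + N <= N + N.
      have := uN x; rewrite ler_norml => /andP[ge le].
      by rewrite lerD2r le -lerBlDr sub0r ge.
    have NN : 0 < N + N by rewrite addr_gt0.
    by rewrite divr_ge0 ?(ltW NN)//= ler_pdivrMr// mul1r.
  pose v : @unit_continuous R X :=
    exist (fun w => w \in @unit_continuous R X) _ uv.
  exists (fun p => set_val p v * (N + N) - N); split=> [p|x].
    have Fp := nbhs_filter p.
    apply: cvgB; last exact: cvg_cst.
    apply: cvgM; last exact: cvg_cst.
    exact: (@stone_cech_proj_continuous R X v p).
  rewrite (_ : set_val _ v = (u x + N) / (N + N))//.
  have NN0 : N + N != 0 by apply/lt0r_neq0/addr_gt0.
  by rewrite -[RHS](addrK N); congr (_ - _); exact: divfK.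
case: k f => f.
  have [M fM] := CB_bounded f.
  exact: (ext (f : X -> R) M (@CB_continuous R RealScalars X f) fM).
have [M fM] := CB_bounded f.
have Re_le (z : R[i]) : `|complex.Re z| <= complex.Re `|z|.
  have := of_real_modulus (z : scalar R ComplexScalars).
  by rewrite -lecR /= => ->; exact: normc_ge_Re.
have Im_le (z : R[i]) : `|complex.Im z| <= complex.Re `|z|.
  have i1 : `|'i%C| = 1 :> R[i].
    by rewrite normc_def /= expr0n expr1n add0r sqrtr1.
  by have := Re_le (z * 'i%C); rewrite ReiNIm normrN normrM i1 mulr1.
have Re_cont : continuous (@complex.Re R : scalar R ComplexScalars -> R).
  move=> z A /nbhs_ballP[e /= e0 eA]; apply/nbhs_ballP.
  exists e%:C%C => [|w zw]; first by rewrite /= ltcR.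
  apply: eA; rewrite /ball/= -raddfB -ltcR.
  exact: le_lt_trans (normc_ge_Re _) zw.
have Im_cont : continuous (@complex.Im R : scalar R ComplexScalars -> R).
  move=> z A /nbhs_ballP[e /= e0 eA]; apply/nbhs_ballP.
  exists e%:C%C => [|w zw]; first by rewrite /= ltcR.
  apply: eA; rewrite /ball/= -raddfB.
  apply: le_lt_trans (Im_le _) _; rewrite -ltcR.
  by have := of_real_modulus (z - w : scalar R ComplexScalars) => /= ->.
have C_cont : continuous (fun x : R => x%:C%C : scalar R ComplexScalars).
  move=> z A /nbhs_ballP[e /= e0 eA]; apply/nbhs_ballP.
  move: e0; rewrite ltcE /= => /andP[/eqP Ime Ree].
  exists (complex.Re e) => // w zw; apply: eA.
  have nC (x : R) : `|x%:C%C| = `|x|%:C%C :> R[i].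
    by rewrite normc_def /= expr0n addr0 sqrtr_sqr.
  by rewrite /ball/= -raddfB nC ltcE /= Ime eqxx.
have [||g [cg gE]] := ext (fun x => complex.Re (f x)) M.
- by move=> x; apply: continuous_comp; [exact: CB_continuous|exact: Re_cont].
- by move=> x; rewrite (le_trans (Re_le _))//; exact: fM.
have [||h [ch hE]] := ext (fun x => complex.Im (f x)) M.
- by move=> x; apply: continuous_comp; [exact: CB_continuous|exact: Im_cont].
- by move=> x; rewrite (le_trans (Im_le _))//; exact: fM.
exists (fun p => (g p)%:C%C + 'i%C * (h p)%:C%C); split=> [p|x].
  have Fp := nbhs_filter p.
  have cgp :
      {for p, continuous (fun p => (g p)%:C%C : scalar R ComplexScalars)}.
    by apply: continuous_comp; [exact: cg|exact: C_cont].
  have chp :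
      {for p, continuous (fun p => (h p)%:C%C : scalar R ComplexScalars)}.
    by apply: continuous_comp; [exact: ch|exact: C_cont].
  apply: (@cvgD (scalar R ComplexScalars)); first exact: cgp.
  by apply: (@cvgM (scalar R ComplexScalars)); [exact: cvg_cst|exact: chp].
by rewrite gE hE -complexE.
Qed.

Lemma stone_ext_continuous (f : CB R k X) : continuous (stone_ext f).
Proof. exact: (xgetPex (fun=> 0) (stone_ext_exists f)).1. Qed.

Lemma stone_extE (f : CB R k X) x : stone_ext f (to_stone_cech x) = f x.
Proof. exact: (xgetPex (fun=> 0) (stone_ext_exists f)).2. Qed.

Lemma stone_ext_unique (f : CB R k X) (g : stone_cech R X -> scalar R k) :
  continuous g -> (forall x, g (to_stone_cech x) = f x) -> g = stone_ext f.
Proof.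
move=> cg gE; apply/funext => p; apply/eqP; rewrite -subr_eq0; apply/negPn/negP.
pose O := [set q | g q - stone_ext f q != 0].
have cO : continuous (fun q => g q - stone_ext f q).
  move=> q; have Fq := nbhs_filter q.
  by apply: (@cvgB (scalar R k)); [exact: cg|exact: stone_ext_continuous].
have oO : open O.
  have cl0 : closed [set (0 : scalar R k)].
    apply/accessible_closed_set1/hausdorff_accessible.
    exact: norm_hausdorff.
  move/continuousP : cO => /(_ (~` [set 0]) (closed_openC cl0)).
  by congr open; apply/seteqP; split=> q /= /eqP.
move=> Op.
have [q [Oq [x _ xq]]] := @to_stone_cech_dense R X O (ex_intro _ p Op) oO.
by move: Oq; rewrite /O /= -xq gE stone_extE subrr eqxx.
Qed.

Definition non_vanishing (H : set (CB R k X)) :=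
  forall x, exists2 h, H h & h x != 0.

Definition spectrum (H : set (CB R k X)) : set (stone_cech R X) :=
  \bigcup_(h in H) coz (stone_ext h).

End stone_extension.

(* Main.v *)
Require Import Defs.
From HB Require Import structures.
From mathcomp Require Import all_boot all_order all_algebra.
From mathcomp Require Import all_classical all_reals all_analysis.
From mathcomp Require Import finmap complex.

(** Write [f^b] for the extension of [f] to the Stone-Cech compactification
    [bX]. Both conditions say the same thing about the open set
    [S = spectrum H] of [bX]: [S] is a disjoint union of cozero sets of [bX].

    Topology ([paracompact_disjoint_coz], [disjoint_coz_paracompact]). In a
    compact Hausdorff space, let [S] be a union of cozero sets of continuous
    functions. If [S] is paracompact, cover it by superlevel sets [{f > e}]
    and take a locally finite open refinement [V]. Each member of [V] lies in a
    compact subset of [S], so a compact subset of [S] meets only finitely many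
    members of [V]. Starting from a point and repeatedly adding the members of
    [V] that meet what was reached so far, one therefore runs through a sequence
    of compact sets; hence the classes of [S] under chains of overlapping
    members of [V], which are clopen in [S], are sigma-compact, and a clopen
    sigma-compact piece of [S] is a cozero set of the ambient space. Conversely
    a cozero set [{c > 0}] is exhausted by the compact sets
    [{c >= 1 / (n + 1)}]; refining a cover separately on the overlapping open
    annuli [{1 / (n + 2) < c < 1 / n}], with finitely many members on each,
    gives a locally finite refinement on each piece, and the pieces are
    disjoint and open.

    Algebra ([closure_ideal_sum_coz], [coz_closure_ideal_sum]). A function [f]
    is in the closure of the ideal generated by a family [h] exactly when
    [coz f^b] is contained in the union of the [coz (h i)^b]. So a closed ideal
    is determined by its spectrum, and [H] is the closure of the ideal
    generated by the [h i] exactly when [S] is the union of the [coz (h i)^b].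
    The sum of the ideals generated by the [h i] is direct exactly when the
    products [h i * h j], [i <> j], vanish, that is, when these cozero sets are
    disjoint. *)

Set Implicit Arguments.
Unset Strict Implicit.
Unset Printing Implicit Defensive.

Import Order.TTheory GRing.Theory Num.Theory.
Import numFieldNormedType.Exports.

Local Open Scope classical_set_scope.
Local Open Scope ring_scope.

(** * Compact sets, local finiteness and paracompact open subspaces *)

(** [compact_cover] for a space that may be empty: a nonempty [K] provides
    the point that [compact_cover] asks for. *)
Lemma compact_finite_subcover (T : topologicalType) (I : choiceType)
    (K : set T) (D : set I) (f : I -> set T) :
  compact K -> (forall i, D i -> open (f i)) -> K `<=` \bigcup_(i in D) f i ->
  exists2 D' : {fset I}, {subset D' <= D} & K `<=` \bigcup_(i in [set` D']) f i.
Proof.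
have [->|/set0P[x _]] := eqVneq K set0; first by exists fset0.
pose Tp : ptopologicalType := HB.pack T (isPointed.Build T x).
by rewrite -[compact K]/(@compact Tp K) compact_cover => /[apply]; exact.
Qed.

(** Each point of [K] has a neighborhood that meets finitely many members of
    [V], and finitely many of these neighborhoods cover [K]. *)
Lemma locally_finite_compact (T : topologicalType) (K : set T)
    (V : set (set T)) : compact K ->
  (forall x, K x -> exists2 N, nbhs x N &
    finite_set [set B | V B /\ B `&` N !=set0]) ->
  finite_set [set B | V B /\ B `&` K !=set0].
Proof.
move=> cK lfV.
have [||D DG KD] := @compact_finite_subcover T (set T) K
    [set N | open N /\ finite_set [set B | V B /\ B `&` N !=set0]] id cK.
- by move=> N [].
- move=> x /lfV[N]; rewrite nbhsE => -[N' [oN' N'x] N'N] fN.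
  exists N' => //; split => //; apply: sub_finite_set fN => B [VB [y [By N'y]]].
  by split=> //; exists y; split => //; exact: N'N.
apply: sub_finite_set
  (_ : _ `<=` \bigcup_(N in [set` D]) [set B | V B /\ B `&` N !=set0]) _.
  move=> B [VB [x [Bx /KD[N DN Nx]]]]; exists N => //; split=> //.
  by exists x.
apply: bigcup_finite => [|N DN]; first exact: finite_fset.
by have /set_mem[] := DG _ DN.
Qed.

(** Since [S] is open, images under the inclusion and preimages translate open
    covers of the subspace [S] into families of open sets of [T] with union
    [S] and back. This allows compactness arguments to take place in [T]. *)
Lemma subspace_paracompactP (T : topologicalType) (S : set T) :
  hausdorff_space T -> open S ->
  paracompact S <->
  forall U : set (set T), U `<=` open -> \bigcup_(A in U) A = S ->
    exists V : set (set T), [/\ V `<=` open, \bigcup_(B in V) B = S,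
      refines V U & forall x, S x -> exists2 N, nbhs x N &
        finite_set [set B | V B /\ B `&` N !=set0]].
Proof.
move=> T2 oS.
have val_cont : continuous (set_val : S -> T) by exact: initial_continuous.
have opre (A : set T) : open A -> open (set_val @^-1` A : set S).
  by move/continuousP : val_cont; exact.
have oval (B : set S) : open B -> open (set_val @` B).
  move=> [W oW <-]; rewrite (_ : _ @` _ = W `&` S); first exact: openI.
  apply/seteqP; split=> [_ [p Wp <-]|x [Wx Sx]].
    by split=> //; exact: set_mem (valP p).
  by exists (SigSub (mem_set Sx)).
split=> [[_ pS] U oU US|pS].
  have [|V [[oV VS] VU lfV]] := pS [set set_val @^-1` A | A in U].
    split=> [_ [A /oU oA <-]|]; first exact: opre.
    apply/seteqP; split=> // p _.
    have [A UA Ap] : (\bigcup_(A in U) A) (set_val p).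
      by rewrite US; exact: set_mem (valP p).
    by exists (set_val @^-1` A) => //; exists A.
  exists [set set_val @` B | B in V].
  split=> [_ [B /oV oB <-]||_ [B VB <-]|x Sx].
  - exact: oval.
  - apply/seteqP; split=> [_ [_ [B _ <-] [p _ <-]]|x Sx].
      exact: set_mem (valP p).
    have : [set: S] (SigSub (mem_set Sx)) by [].
    rewrite -VS => -[B VB Bx]; exists (set_val @` B); first by exists B.
    by exists (SigSub (mem_set Sx)).
  - have [_ [A UA <-] BA] := VU _ VB; exists A => // _ [p /BA Ap <-] //.
  have [N nN fN] := lfV (SigSub (mem_set Sx)).
  exists (set_val @` N).
    move: nN; rewrite nbhsE => -[N' [oN' N'x] N'N].
    rewrite nbhsE; exists (set_val @` N'); last exact: image_subset.
    by split; [exact: oval|exists (SigSub (mem_set Sx))].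
  apply: sub_finite_set (finite_image (fun B => set_val @` B) fN).
  move=> _ [[B VB <-] [_ [[p Bp <-] [q Nq /val_inj qp]]]].
  by exists B => //; split=> //; exists p; split; rewrite // -qp.
split=> [p q pq|U [oU US]].
  apply/val_inj/T2 => A B pA qB.
  have [r [rA rB]] := pq _ _ (val_cont p A pA) (val_cont q B qB).
  by exists (set_val r).
have [||V [oV VS VU lfV]] := pS [set set_val @` A | A in U].
- by move=> _ [A /oU oA <-]; exact: oval.
- apply/seteqP; split=> [_ [_ [A _ <-] [p _ <-]]|x Sx].
    exact: set_mem (valP p).
  have : [set: S] (SigSub (mem_set Sx)) by [].
  rewrite -US => -[A UA Ax]; exists (set_val @` A); first by exists A.
  by exists (SigSub (mem_set Sx)).
exists [set set_val @^-1` B | B in V]; split.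
- split=> [_ [A /oV oA <-]|]; first exact: opre.
  apply/seteqP; split=> // p _.
  have [A VA Ap] : (\bigcup_(A in V) A) (set_val p).
    by rewrite VS; exact: set_mem (valP p).
  by exists (set_val @^-1` A) => //; exists A.
- move=> _ [B /VU[_ [A UA <-] BA] <-]; exists A => // p /BA[q Aq /val_inj <-//].
- move=> p; have [N nN fN] := lfV (set_val p) (set_mem (valP p)).
  exists (set_val @^-1` N); first exact: val_cont.
  apply: sub_finite_set (finite_image (fun B => set_val @^-1` B) fN).
  move=> _ [[B VB <-] [q [Bq Nq]]]; exists B => //; split=> //.
  by exists (set_val q).
Qed.

(** * Cozero sets of real functions *)

Section levels.
Context {R : realType} {T : topologicalType}.
Implicit Types f : T -> R.

Lemma open_superlevel f e : continuous f -> open [set x | e < f x].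
Proof.
by move=> cf; apply: (@open_comp _ _ f [set y | e < y]) => //; exact: open_gt.
Qed.

Lemma open_sublevel f e : continuous f -> open [set x | f x < e].
Proof.
by move=> cf; apply: (@open_comp _ _ f [set y | y < e]) => //; exact: open_lt.
Qed.

Lemma compact_superlevel f e : compact [set: T] -> continuous f ->
  compact [set x | e <= f x].
Proof.
move=> cT cf; apply: subclosed_compact cT (@subsetT _ _).
by apply: (@closed_comp _ _ f [set y | e <= y]) => //; exact: closed_ge.
Qed.

Lemma coz_pos f : (forall x, 0 <= f x) -> coz f = [set x | 0 < f x].
Proof.
by move=> f0; apply/seteqP; split=> x; rewrite /coz /= lt0r f0 andbT.
Qed.

Lemma open_coz f : (forall x, 0 <= f x) -> continuous f -> open (coz f).
Proof. by move=> f0 cf; rewrite coz_pos//; exact: open_superlevel. Qed.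

Lemma continuous_sum (I : Type) (r : seq I) (f : I -> T -> R) :
  (forall i, continuous (f i)) -> continuous (fun x => \sum_(i <- r) f i x).
Proof.
move=> cf x; have Fx := nbhs_filter x.
by apply: cvg_big => [|i _]; [exact: add_continuous|exact: cf].
Qed.

(** The witness is a finite sum of the given functions, cut off at [1]. *)
Lemma compact_sub_coz (I : choiceType) (J : set I) (f : I -> T -> R)
    (K : set T) :
  (forall i, continuous (f i)) -> (forall i x, 0 <= f i x) -> compact K ->
  K `<=` \bigcup_(i in J) coz (f i) ->
  exists u : T -> R, [/\ continuous u, forall x, 0 <= u x <= 1, K `<=` coz u &
    coz u `<=` \bigcup_(i in J) coz (f i)].
Proof.
move=> cf f0 cK KJ.
have [|D DJ KD] := compact_finite_subcover cK _ KJ.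
  by move=> i _; exact: open_coz.
pose s x := \sum_(i <- enum_fset D) f i x.
have s0 x : 0 <= s x by apply: sumr_ge0 => i _; exact: f0.
exists (fun x => Num.min 1 (s x)); split.
- move=> x; have Fx := nbhs_filter x.
  apply: (@continuous_min R T (cst 1) s x); first exact: cvg_cst.
  exact: continuous_sum.
- by move=> x; rewrite le_min s0 ler01 ge_min lexx.
- move=> x /KD[i /= iD fix0]; rewrite /coz /= gt_eqF// lt_min ltr01 /=.
  rewrite /s (big_rem i)//= ltr_wpDr//; first by apply: sumr_ge0.
  by rewrite lt0r f0 andbT.
move=> x sx; apply: contrapT => xJ; move: sx; rewrite /coz /=.
rewrite /s big_seq big1 ?minr_l ?ltr01//; first by rewrite minElt ltr10 eqxx.
move=> i iD; apply/eqP/negPn/negP => fix0; apply: xJ; exists i => //.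
exact/set_mem/DJ.
Qed.

(** The witness is [sup_n u n / (n + 1)]. The weights make all but finitely
    many terms uniformly small, so near a point only finitely many of them
    matter, whence continuity. *)
Lemma coz_bigcup_nat (u : nat -> T -> R) : (forall n, continuous (u n)) ->
  (forall n x, 0 <= u n x <= 1) ->
  exists c : T -> R, [/\ continuous c, forall x, 0 <= c x <= 1 &
    coz c = \bigcup_n coz (u n)].
Proof.
move=> cu u01; pose g n x := u n x / n.+1%:R.
pose c x := sup (range (g^~ x)).
have g_ge0 n x : 0 <= g n x by have /andP[? _] := u01 n x; rewrite divr_ge0.
have g_le n x : g n x <= n.+1%:R^-1.
  by have /andP[_ ?] := u01 n x; rewrite ler_piMl.
have g_c n x : g n x <= c x.
  apply: ub_le_sup; last by exists n.
  by exists 1 => _ [m _ <-]; rewrite (le_trans (g_le _ _))// invf_le1// ler1n.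
have c_le x M : (forall n, g n x <= M) -> c x <= M.
  by move=> gM; apply: ge_sup => [|_ [n _ <-]//]; exists (g 0%N x), 0%N.
have c0 x : 0 <= c x by exact: le_trans (g_c 0%N x).
have c1 x : c x <= 1.
  by apply: c_le => n; rewrite (le_trans (g_le n x))// invf_le1// ler1n.
exists c; split=> [|x|]; [|by rewrite c0 c1|]; last first.
  rewrite coz_pos//; apply/seteqP; split=> x /= => [cx|[n _ unx]].
    apply: contrapT => ux; move: cx; rewrite ltNge => /negP; apply.
    apply: c_le => n; rewrite /g (_ : u n x = 0) ?mul0r//.
    by apply/eqP/negPn/negP => unx; apply: ux; exists n.
  apply: lt_le_trans (g_c n x); rewrite divr_gt0// lt0r unx.
  by have /andP[] := u01 n x.
move=> x; have Fx := nbhs_filter x; apply/cvgrPdist_le => e e0.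
have [N Ne] : exists N : nat, N.+1%:R^-1 <= e.
  exists (Num.trunc e^-1); rewrite -[leRHS]invrK lef_pV2 ?posrE ?invr_gt0//.
  exact/ltW/truncnS_gt.
have : \forall y \near x, forall n : 'I_N, `|g n x - g n y| < e.
  apply: filter_forall => n; have : g n y @[y --> x] --> g n x.
    by apply: cvgM; [exact: cu|exact: cvg_cst].
  by move=> /cvgrPdist_lt; exact.
apply: filterS => y gxy.
have close_le a b : (forall n : 'I_N, `|g n a - g n b| < e) -> c a <= c b + e.
  move=> gab; apply: c_le => n; have [nN|Nn] := ltnP n N.
    have := ltW (gab (Ordinal nN)); rewrite ler_distl => /andP[_] /= /le_trans.
    by apply; rewrite lerD2r.
  apply: (le_trans (g_le n a)); apply: ler_wpDl => //; apply: le_trans Ne.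
  by rewrite lef_pV2 ?posrE// ler_nat ltnS.
rewrite ler_distl; apply/andP; split; last exact: close_le.
by rewrite lerBlDr; apply: close_le => n; rewrite distrC.
Qed.

End levels.

(** * Paracompactness and partitions into cozero sets *)

Section partition.
Context {R : realType} {T : topologicalType}.
Context (T_compact : compact [set: T]) (T_T2 : hausdorff_space T).

(** On the piece [coz (c i)] a cover is refined on annuli: finitely many of
    its members cover the compact set [{1 / (n + 1) <= c i}], and their traces
    on the annulus [{1 / (n + 2) < c i < 1 / n}] are kept. The neighborhood
    [{1 / N < c i}] of a point meets no other piece, and no annulus of index
    [n >= N]. Inequalities are multiplied out so that [n = 0] is not
    special. *)
Lemma disjoint_coz_paracompact (I : choiceType) (c : I -> T -> R) :
  (forall i, continuous (c i)) -> (forall i x, 0 <= c i x) ->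
  (forall i j, i <> j -> coz (c i) `&` coz (c j) = set0) ->
  paracompact (\bigcup_i coz (c i)).
Proof.
move=> cc c0 cD.
have oS : open (\bigcup_i coz (c i)).
  by apply: (@bigcup_open T I) => i _; exact: open_coz.
apply/(subspace_paracompactP T_T2 oS) => U oU US.
have ccM i n : continuous (fun x => c i x * n%:R).
  by move=> x; apply: cvgM; [exact: cc|exact: cvg_cst].
have /choice[D DP] : forall p : I * nat, exists D : {fset set T},
    {subset D <= U} /\ [set x | 1 <= c p.1 x * p.2.+1%:R] `<=`
      \bigcup_(A in [set` D]) A.
  move=> [i n] /=.
  have [||x cx|D DU KD] := @compact_finite_subcover T (set T)
    [set x | 1 <= c i x * n.+1%:R] U id.
  - exact: compact_superlevel.
  - exact: oU.
  - rewrite [X in X x]US; exists i => //=; apply/eqP => cx0.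
    by move: cx; rewrite /= cx0 mul0r ler10.
  by exists D.
pose ann i n := [set x | c i x * n%:R < 1] `&` [set x | 1 < c i x * n.+2%:R].
have annP i n x : ann i n x -> coz (c i) x.
  by case=> _ /= cx; apply/eqP => cx0; rewrite cx0 mul0r ltr10 in cx.
exists [set B | exists i n, exists2 A, A \in D (i, n) & B = A `&` ann i n].
split.
- move=> _ [i [n [A /(DP _).1 /set_mem/oU oA ->]]].
  apply: openI => //.
  by apply: openI; [exact: open_sublevel|exact: open_superlevel].
- apply/seteqP; split=> [x [_ [i [n [A _ ->]]] [_ /annP]]|x [i _ cix]].
    by exists i.
  have cpos : 0 < c i x by rewrite lt0r c0 andbT.
  have ex : exists n, 1 <= c i x * n.+1%:R.
    exists (Num.trunc (c i x)^-1).
    by rewrite -ler_pdivrMl// mulr1; exact/ltW/truncnS_gt.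
  case: (ex_minnP ex) => n cn nmin.
  have [A /= AD Ax] := (DP (i, n)).2 x cn.
  exists (A `&` ann i n); first by exists i, n, A.
  split=> //; split=> /=.
    (* minimality of n: the inequality fails for n - 1 *)
    case: n nmin {cn AD} => [_|n nmin]; first by rewrite mulr0.
    by rewrite ltNge; apply/negP => /nmin; rewrite ltnn.
  by apply: le_lt_trans cn _; rewrite ltr_pM2l// ltr_nat.
- by move=> _ [i [n [A /(DP _).1 /set_mem UA ->]]]; exists A.
move=> x [i _ cix].
have cpos : 0 < c i x by rewrite lt0r c0 andbT.
pose N := (Num.trunc (c i x)^-1).+1.
exists [set y | 1 < c i y * N%:R].
  apply: open_nbhs_nbhs; split; first exact: open_superlevel.
  by rewrite /= -ltr_pdivrMl// mulr1; exact: truncnS_gt.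
apply: (@sub_finite_set _ _
    (\bigcup_(n in `I_N) ((fun A => A `&` ann i n) @` [set` D (i, n)]))).
  move=> _ [[j [n [A AD ->]]] [y [[Ay annjy] /= ciy]]].
  have ij : i = j.
    apply: contrapT => /cD/seteqP[+ _] => /(_ y); apply; split.
      by apply/eqP => cy0; rewrite cy0 mul0r ltr10 in ciy.
    exact: annP annjy.
  subst j; exists n; last by exists A.
  case: annjy => /= /lt_trans/(_ ciy); rewrite ltr_pM2l ?ltr_nat//.
  rewrite lt0r c0 andbT; apply/eqP => cy0.
  by rewrite cy0 mul0r ltr10 in ciy.
apply: bigcup_finite => // n _.
exact/finite_image/finite_fset.
Qed.

Section saturation.
Context (S : set T) (V : set (set T)).
Context (V_open : V `<=` open) (V_cover : \bigcup_(A in V) A = S).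

(** The saturated sets are the unions of classes of [S] under chains of
    overlapping members of [V]. Describing the class of a point as the least
    saturated set that contains it avoids the chains: that the classes form a
    partition follows from the fact that complements of saturated sets are
    saturated. *)
Definition saturated (C : set T) :=
  C `<=` S /\ forall A, V A -> A `&` C !=set0 -> A `<=` C.

Definition component (y : T) : set T :=
  [set z | S z /\ forall C, saturated C -> C y -> C z].

Lemma saturated_open C : saturated C -> open C.
Proof.
move=> [CS Csat].
rewrite (_ : C = \bigcup_(A in [set A | V A /\ A `<=` C]) A).
  by apply: bigcup_open => A [/V_open].
apply/seteqP; split=> [x Cx|x [A [_ subC] Ax]]; last exact: subC.
have : S x by exact: CS.
rewrite -V_cover => -[A VA Ax]; exists A => //; split=> //.
by apply: Csat => //; exists x.
Qed.

Lemma saturatedD C : saturated C -> saturated (S `\` C).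
Proof.
move=> [CS Csat]; split; first exact: subDsetl.
move=> A VA [x [Ax [Sx Cx]]] z Az; split; first by rewrite -V_cover; exists A.
by move=> Cz; apply/Cx/(Csat A) => //; exists z.
Qed.

Lemma component_refl y : S y -> component y y. Proof. by []. Qed.

Lemma component_saturated y : saturated (component y).
Proof.
split=> [z []//|A VA [z [Az [Sz yz]]] w Aw].
split=> [|C Csat Cy]; first by rewrite -V_cover; exists A.
by have [_ /(_ A VA)] := Csat; apply=> //; exists z; split => //; exact: yz.
Qed.

Lemma component_sub y C : saturated C -> C y -> component y `<=` C.
Proof. by move=> Csat Cy z [_]; apply. Qed.

(** If [y] were not in the component of [w], the complement of the latter
    would be a saturated set containing [y], hence [w]. *)
Lemma component_eq y w : S y -> component y w -> component w = component y.
Proof.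
move=> Sy yw; apply/seteqP; split.
  by apply: component_sub => //; exact: component_saturated.
apply: component_sub; first exact: component_saturated.
apply: contrapT => wy; have Sw := yw.1.
have /(_ w) := component_sub (saturatedD (component_saturated w)) (conj Sy wy).
by move=> /(_ yw) [_]; apply.
Qed.

End saturation.

(** Off [S] there is nothing to check besides continuity of [f] itself, since
    [f] vanishes there and [|f|] dominates the restriction. *)
Lemma continuous_restrict_clopen (S C : set T) (f : T -> R) :
  continuous f -> coz f `<=` S -> open C -> open (S `\` C) ->
  continuous (fun x => if x \in C then f x else 0).
Proof.
move=> cf fS oC oSC x; pose g x := if x \in C then f x else 0.
have Fx := nbhs_filter x; change (g y @[y --> x] --> g x).
have [Cx|Cx] := pselect (C x).
  rewrite (_ : g x = f x); last by rewrite /g mem_set.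
  apply: cvg_trans (cf x); apply: near_eq_cvg.
  have : nbhs x C by exact: open_nbhs_nbhs.
  by apply: filterS => y Cy; rewrite /g mem_set.
have gx : g x = 0 by rewrite /g memNset.
have [Sx|Sx] := pselect (S x).
  rewrite gx; apply: cvg_trans (@cvg_cst _ 0 _ (nbhs x) _).
  apply: near_eq_cvg.
  have : nbhs x (S `\` C) by exact: open_nbhs_nbhs.
  by apply: filterS => y [_ Cy]; rewrite /g memNset.
have fx : f x = 0 by apply/eqP/negPn/negP => /fS.
rewrite gx; apply/cvgr0Pnorm_lt => e e0.
have /cvgrPdist_lt/(_ e e0) := cf x; rewrite fx.
apply: filterS => y; rewrite sub0r normrN /g.
by case: ifPn => // _ _; rewrite normr0.
Qed.

(** The functions are indexed by all subsets of [T]: [c C] has cozero set [C]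
    if [C] is a component for the refinement [V], and is [0] otherwise. *)
Lemma paracompact_disjoint_coz (I : choiceType) (J : set I) (f : I -> T -> R) :
  (forall i, continuous (f i)) -> (forall i x, 0 <= f i x) ->
  paracompact (\bigcup_(i in J) coz (f i)) ->
  exists c : set T -> T -> R, [/\ forall C, continuous (c C),
    forall C x, 0 <= c C x <= 1,
    forall C D, C <> D -> coz (c C) `&` coz (c D) = set0 &
    \bigcup_C coz (c C) = \bigcup_(i in J) coz (f i)].
Proof.
move=> cf f0; set S := \bigcup_(i in J) _.
have oS : open S by apply: (@bigcup_open T I) => i _; exact: open_coz.
move=> /(subspace_paracompactP T_T2 oS) pS.
have [||V [oV VS VU lfV]] := pS [set B | exists i e,
    [/\ J i, 0 < e & B = [set x | e < f i x]]].
- by move=> _ [i [e [_ _ ->]]]; exact: open_superlevel.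
- apply/seteqP; split=> [x [_ [i [e [Ji e0 ->]]] /= ex]|x [i Ji fx]].
    by exists i => //; rewrite /coz /= gt_eqF// (lt_trans e0).
  have fx0 : 0 < f i x by rewrite lt0r f0 andbT.
  exists [set y | f i x / 2 < f i y]; last first.
    by rewrite /= ltr_pdivrMr// ltr_pMr// ltr1n.
  by exists i, (f i x / 2); rewrite divr_gt0.
have bounded A : V A -> exists K, [/\ compact K, K `<=` S & A `<=` K].
  move=> /VU[_ [i [e [Ji e0 ->]]] Ae]; exists [set x | e <= f i x]; split.
  - exact: compact_superlevel.
  - move=> x /= ex; exists i => //.
    by rewrite /coz /= gt_eqF// (lt_le_trans e0).
  - by move=> x /Ae /ltW.
(* The bound K' absorbs the members of V that meet K; iterating from a point
   exhausts its component by compact sets. *)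
have /choice[next nextP] : forall K : set T, exists K', compact K -> K `<=` S ->
    [/\ compact K', K' `<=` S &
      forall A, V A -> A `&` K !=set0 -> A `<=` K'].
  move=> K; have [cK|?] := pselect (compact K); last by exists K.
  have [KS|?] := pselect (K `<=` S); last by exists K.
  have /choice[k kP] : forall A, exists K, V A ->
      [/\ compact K, K `<=` S & A `<=` K].
    move=> A; have [/bounded[L ?]|?] := pselect (V A); first by exists L.
    by exists set0.
  have finV : finite_set [set B | V B /\ B `&` K !=set0].
    by apply: locally_finite_compact => // x /KS /lfV.
  exists (\bigcup_(A in [set B | V B /\ B `&` K !=set0]) k A) => _ _; split.
  - rewrite -(fset_setK finV) bigcup_fset.
    rewrite big_seq; apply: bigsetU_compact => A.
    by rewrite in_fset_set// => /set_mem[/kP[]].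
  - by move=> x [A [/kP[_ kS _] _]]; exact: kS.
  - by move=> A VA AK x Ax; exists A => //; have [_ _] := kP A VA; exact.
have component_coz y : S y -> exists c : T -> R, [/\ continuous c,
    forall x, 0 <= c x <= 1 & coz c = component S V y].
  move=> Sy; pose K n := iter n next [set y].
  have KP n : compact (K n) /\ K n `<=` S.
    elim: n => [|n [cK KS]]; first by split; [exact: compact_set1|move=> _ ->].
    by have [] := nextP (K n) cK KS.
  have /choice[u uP] : forall n, exists u : T -> R, [/\ continuous u,
      forall x, 0 <= u x <= 1, K n `<=` coz u & coz u `<=` S].
    by move=> n; have [cK KS] := KP n; exact: compact_sub_coz.
  have [||v [cv v0 vE]] := @coz_bigcup_nat R T u.
  - by move=> n; have [] := uP n.
  - by move=> n x; have [_ ->] := uP n.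
  have vS : coz v `<=` S by rewrite vE => x [n _]; have [_ _ _] := uP n; exact.
  pose C := component S V y.
  have Csat : saturated S V C by exact: component_saturated.
  exists (fun x => if x \in C then v x else 0); split.
  - apply: continuous_restrict_clopen cv vS _ _.
      exact: saturated_open Csat.
    by apply: (@saturated_open S V) => //; exact: saturatedD.
  - by move=> x; case: ifP => // _; rewrite lexx ler01.
  apply/seteqP; split=> x; rewrite /coz /=.
    by case: ifPn => [/set_mem//|_]; rewrite eqxx.
  rewrite -/C => Cx; rewrite mem_set//.
  (* The union of the K n is saturated and contains y. *)
  suff [n _ Knx] : (\bigcup_n K n) x.
    have : coz v x by rewrite vE; exists n => //; have [_ _ + _] := uP n; exact.
    by [].
  apply: component_sub Cx; last by exists 0%N.
  split=> [z [n _]|A VA [z [Az [n _ Knz]]]]; first by have [_] := KP n; exact.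
  have [cK KS] := KP n.
  have [_ _ /(_ A VA) AK] := nextP (K n) cK KS.
  by move=> w Aw; exists n.+1 => //=; apply: AK => //; exists z.
pose is_component C := exists2 y, S y & C = component S V y.
have /choice[c cP] : forall C, exists c : T -> R, [/\ continuous c,
    forall x, 0 <= c x <= 1 & coz c = [set x | is_component C /\ C x]].
  move=> C; have [[y Sy CE]|nC] := pselect (is_component C).
    have [v [cv v0 vE]] := component_coz y Sy; exists v; split => //.
    rewrite vE -CE; apply/seteqP; split=> [x Cx|x []//].
    by split=> //; exists y.
  exists (fun=> 0); split.
  - by move=> x; exact: cvg_cst.
  - by move=> x; rewrite lexx ler01.
  by apply/seteqP; split=> [x|x []//]; rewrite /coz /= eqxx.
exists c; split.
- by move=> C; have [] := cP C.
- by move=> C; have [] := cP C.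
- move=> C D CD; have [_ _ ->] := cP C; have [_ _ ->] := cP D.
  apply/seteqP; split=> // x [/= [[y Sy CE] Cx] [[z Sz DE] Dx]]; apply: CD.
  rewrite CE DE -(@component_eq S V _ y x)//; last by rewrite -CE.
  by rewrite -(@component_eq S V _ z x)// -DE.
apply/seteqP; split=> [x [C _]|x Sx].
  by have [_ _ ->] := cP C; case=> -[y _ ->] [].
exists (component S V x) => //; have [_ _ ->] := cP (component S V x).
by split; [exists x|exact: component_refl].
Qed.

End partition.

(** * Modulus and conjugation of scalars *)

Definition scalar_conj (R : realType) (k : scalar_kind) :
    Defs.scalar R k -> Defs.scalar R k :=
  match k return Defs.scalar R k -> Defs.scalar R k with
  | RealScalars => fun x => x
  | ComplexScalars => fun z => z^*%C
  end.

Section scalars.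
Context (R : realType) (k : scalar_kind).
Local Notation F := (Defs.scalar R k).

Lemma modulus0 : modulus (0 : F) = 0.
Proof.
by apply: (@of_real_inj R k); rewrite of_real_modulus of_real0 normr0.
Qed.

Lemma modulus_eq0 (x : F) : (modulus x == 0) = (x == 0).
Proof. by apply/eqP/eqP => [/modulus0_eq0//|->]; exact: modulus0. Qed.

Lemma modulusN (x : F) : modulus (- x) = modulus x.
Proof. by apply: (@of_real_inj R k); rewrite !of_real_modulus normrN. Qed.

Lemma modulus_of_real (a : R) : modulus (of_real k a) = `|a|.
Proof.
case: k => //; rewrite /modulus /of_real normc_def /=.
by rewrite expr0n addr0 sqrtr_sqr.
Qed.

Lemma modulus_dist (x y : F) : `|modulus x - modulus y| <= modulus (x - y).
Proof.
rewrite ler_distl; apply/andP; split.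
  rewrite lerBlDr -(modulusN (x - y)) opprB.
  by have := modulusD x (y - x); rewrite [x + (y - x)]addrC subrK.
by have := modulusD y (x - y); rewrite [y + (x - y)]addrC subrK.
Qed.

Lemma ltr_of_real (a b : R) : (of_real k a < of_real k b) = (a < b).
Proof. by rewrite !lt_neqAle ler_of_real (inj_eq (@of_real_inj _ _)). Qed.

Lemma of_realB (a b : R) : of_real k (a - b) = of_real k a - of_real k b.
Proof. by case: k => //=; rewrite rmorphB. Qed.

(** The radii of balls are scalars; this replaces them by real numbers. *)
Lemma scalar_cvgP (T : Type) (G : set_system T) {FG : Filter G}
    (f : T -> F) (l : F) :
  f @ G --> l <->
  forall e : R, 0 < e -> \forall t \near G, modulus (l - f t) < e.
Proof.
split=> [/cvgrPdist_lt fl e e0|fl].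
  have /fl : 0 < of_real k e by rewrite -(of_real0 R k) ltr_of_real.
  by apply: filterS => t; rewrite -of_real_modulus ltr_of_real.
apply/cvgrPdist_lt => e e0.
have eE : of_real k (modulus e) = e by rewrite of_real_modulus gtr0_norm.
have /fl : 0 < modulus e by rewrite -ltr_of_real eE of_real0.
by apply: filterS => t; rewrite -ltr_of_real eE of_real_modulus.
Qed.

Lemma near_modulus (x : F) (e : R) : 0 < e ->
  \forall y \near x, modulus (x - y) < e.
Proof.
move=> e0; have Fx := nbhs_filter x.
have idx : id @ nbhs x --> x by exact: cvg_id.
exact: ((@scalar_cvgP F (nbhs x) Fx id x).1 idx e e0).
Qed.

Lemma continuous_modulus : continuous (@modulus R k).
Proof.
move=> x; have Fx := nbhs_filter x.
apply/(@cvgrPdist_lt R R F (nbhs x) Fx) => e e0.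
by apply: filterS (near_modulus x e0) => y; exact/le_lt_trans/modulus_dist.
Qed.

Lemma continuous_of_real : continuous (@of_real R k).
Proof.
move=> a; have Fa := nbhs_filter a.
apply/(@scalar_cvgP R (nbhs a) Fa) => e e0.
have ida : id @ nbhs a --> a by exact: cvg_id.
apply: filterS ((@cvgrPdist_lt R R R (nbhs a) Fa id a).1 ida e e0) => b.
by rewrite -of_realB modulus_of_real.
Qed.

Lemma scalar_conjB (x y : F) :
  scalar_conj (x - y) = scalar_conj x - scalar_conj y.
Proof. by case: k x y => //= x y; rewrite rmorphB. Qed.

Lemma modulus_conj (x : F) : modulus (scalar_conj x) = modulus x.
Proof.
by case: k x => // -[a b]; rewrite /modulus /scalar_conj !normc_def /= sqrrN.
Qed.

Lemma mulr_conj (x : F) : scalar_conj x * x = of_real k (modulus x ^+ 2).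
Proof.
case: k x => x; first by rewrite /= -normrX ger0_norm ?sqr_ge0.
case: x => a b; rewrite /modulus /of_real /scalar_conj normc_def /=.
rewrite sqr_sqrtr ?addr_ge0 ?sqr_ge0//.
apply/eqP; rewrite eq_complex /= -!expr2 mulNr opprK eqxx /=.
by rewrite mulNr mulrC subrr.
Qed.

Lemma continuous_conj : continuous (@scalar_conj R k).
Proof.
move=> x; have Fx := nbhs_filter x.
apply/(@scalar_cvgP F (nbhs x) Fx) => e e0.
by apply: filterS (near_modulus x e0) => y; rewrite -scalar_conjB modulus_conj.
Qed.

End scalars.

(** * Sums of principal ideals *)

Lemma ideal_sum_sub (A : comPzRingType) (I : choiceType) (J : set I)
    (G : I -> set A) (Q : set A) : Q 0 ->
  (forall f g, Q f -> Q g -> Q (f + g)) -> (forall i, J i -> G i `<=` Q) ->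
  ideal_sum J G `<=` Q.
Proof.
move=> Q0 QD GQ f [D [g [finD DJ Gg ->]]]; rewrite fsbig_finite// big_seq.
elim/big_rec : _ => // i a; rewrite in_fset_set// => /set_mem Di Qa.
by apply: QD => //; apply: (GQ i (DJ i Di)); exact: Gg.
Qed.

Lemma principal_ideal_id (A : comPzRingType) (h : A) : principal_ideal h h.
Proof. by rewrite principal_idealE; exists 1; rewrite // mul1r. Qed.

Lemma principal_ideal_sub (A : comPzRingType) (H : set A) (h : A) :
  is_ideal H -> H h -> principal_ideal h `<=` H.
Proof.
by move=> [_ _ HM] Hh; rewrite principal_idealE => _ [a _ <-]; exact: HM.
Qed.

(** * Closed ideals and extensions to the Stone-Cech compactification *)

Section stone_ext_theory.
Context {R : realType} {k : scalar_kind} {X : topologicalType}.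
Local Notation F := (Defs.scalar R k).
Implicit Types f g : CB R k X.

Lemma stone_ext0 p : stone_ext (0 : CB R k X) p = 0.
Proof.
rewrite -(@stone_ext_unique R k X 0 (fun=> 0))// => q.
by have Fq := nbhs_filter q; exact: cvg_cst.
Qed.

Lemma stone_extD f g p : stone_ext (f + g) p = stone_ext f p + stone_ext g p.
Proof.
rewrite -(@stone_ext_unique R k X (f + g)
    (fun q => stone_ext f q + stone_ext g q))// => [q|x].
  have Fq := nbhs_filter q.
  by apply: (@cvgD F); exact: stone_ext_continuous.
by rewrite !stone_extE.
Qed.

Lemma stone_extM f g p : stone_ext (f * g) p = stone_ext f p * stone_ext g p.
Proof.
rewrite -(@stone_ext_unique R k X (f * g)
    (fun q => stone_ext f q * stone_ext g q))// => [q|x].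
  have Fq := nbhs_filter q.
  by apply: (@cvgM F); exact: stone_ext_continuous.
by rewrite !stone_extE.
Qed.

Lemma continuous_modulus_stone_ext f :
  continuous (fun p => modulus (stone_ext f p)).
Proof.
move=> p; apply: continuous_comp; first exact: stone_ext_continuous.
exact: continuous_modulus.
Qed.

(** The bound holds on the dense image of [X]. *)
Lemma stone_ext_le_supnorm f p : modulus (stone_ext f p) <= supnorm f.
Proof.
rewrite leNgt; apply/negP => fp.
have [||q [/= fq [x _ xq]]] := @to_stone_cech_dense R X
    [set q | supnorm f < modulus (stone_ext f q)].
- by exists p.
- by apply: open_superlevel; exact: continuous_modulus_stone_ext.
by move: fq; rewrite -xq stone_extE ltNge supnorm_ub.
Qed.

Lemma coz_modulus (Y : Type) (f : Y -> F) :
  coz (fun y => modulus (f y)) = coz f.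
Proof. by apply/seteqP; split=> y; rewrite /coz /= modulus_eq0. Qed.

Lemma ideal_sum_stone_ext_eq0 (I : choiceType) (J : set I)
    (h : I -> CB R k X) p f : (forall i, J i -> stone_ext (h i) p = 0) ->
  ideal_sum J (fun i => principal_ideal (h i)) f -> stone_ext f p = 0.
Proof.
move=> hp; move: f; apply: (@ideal_sum_sub _ _ _ _ [set f | stone_ext f p = 0]).
- exact: stone_ext0.
- by move=> f g /= fp gp; rewrite stone_extD fp gp addr0.
move=> i Ji f; rewrite principal_idealE /= => -[a _ <-].
by rewrite stone_extM hp// mulr0.
Qed.

(** Members of the ideal vanish, after extension, wherever all the [h i] do,
    and a uniform approximation on [X] remains one on the compactification. *)
Lemma closure_ideal_sum_coz (I : choiceType) (J : set I) (h : I -> CB R k X) :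
  closure (ideal_sum J (fun i => principal_ideal (h i))) `<=`
  [set f | coz (stone_ext f) `<=` \bigcup_(i in J) coz (stone_ext (h i))].
Proof.
move=> f /CB_closureP clf p fp; apply: contrapT => pJ.
have e0 : 0 < modulus (stone_ext f p).
  by rewrite lt0r modulus_eq0 fp modulus_ge0.
have [g Jg fg] := clf _ e0.
have gp : stone_ext g p = 0.
  apply: ideal_sum_stone_ext_eq0 Jg => i Ji; apply/eqP/negPn/negP => hip.
  by apply: pJ; exists i.
have := stone_ext_le_supnorm (f - g) p.
have -> : stone_ext (f - g) p = stone_ext f p.
  by rewrite -[in RHS](subrK g f) [RHS]stone_extD gp addr0.
by rewrite leNgt fg.
Qed.

(** Given [e], the compact set [K = {|f^b| >= e / 2}] is covered by finitely
    many [coz (h i)^b], so [s = \sum_i |h i|^2 = \sum_i (h i)^* h i] is bounded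
    below on [K] by some [d > 0]. Then [f s / (s + eta)] is in the sum of the
    principal ideals and differs from [f] by [f eta / (s + eta)], which is
    smaller than [f] everywhere, hence small off [K], and at most
    [|f| eta / d] on [K]. *)
Lemma coz_closure_ideal_sum (I : choiceType) (J : set I) (h : I -> CB R k X) :
  [set f | coz (stone_ext f) `<=` \bigcup_(i in J) coz (stone_ext (h i))] `<=`
  closure (ideal_sum J (fun i => principal_ideal (h i))).
Proof.
move=> f /= fJ; apply/CB_closureP => e e0.
pose m i p := modulus (stone_ext (h i) p).
have cm i : continuous (m i) by exact: continuous_modulus_stone_ext.
have m0 i p : 0 <= m i p by exact: modulus_ge0.
pose K := [set p | e / 2 <= modulus (stone_ext f p)].
have cK : compact K.
  apply: compact_superlevel; first exact: stone_cech_compact.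
  exact: continuous_modulus_stone_ext.
have e20 : 0 < e / 2 by rewrite divr_gt0.
have [i _|p|D DJ KD] :=
  @compact_finite_subcover _ I K J (fun i => coz (m i)) cK.
- exact: open_coz.
- move=> fp; have [|i Ji hip] := fJ p.
    by rewrite /coz /= -modulus_eq0 gt_eqF// (lt_le_trans _ fp).
  by exists i => //; rewrite coz_modulus.
pose s p := \sum_(i <- enum_fset D) m i p ^+ 2.
have cs : continuous s.
  apply: continuous_sum => i p.
  exact: (@continuous_comp _ _ _ (m i) (fun y => y ^+ 2) p (cm i p)
    (@exprn_continuous R 2 _)).
have s0 p : 0 <= s p by apply: sumr_ge0 => i _; exact: sqr_ge0.
have [d d0 dK] : exists2 d, 0 < d & forall p, K p -> d <= s p.
  have [||E _ KE] := @compact_finite_subcover _ nat K setT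
    (fun n => [set p | n.+1%:R^-1 < s p]) cK.
  - by move=> n _; exact: open_superlevel.
  - move=> p /KD[i /= iD mip].
    have sp : 0 < s p.
      rewrite /s (big_rem i)//= ltr_wpDr//.
        by apply: sumr_ge0 => j _; exact: sqr_ge0.
      by rewrite exprn_gt0// lt0r m0 andbT.
    exists (Num.trunc (s p)^-1) => //=.
    by rewrite -[ltRHS]invrK ltf_pV2 ?posrE ?invr_gt0// truncnS_gt.
  exists (\max_(n <- enum_fset E) n).+1%:R^-1; first by rewrite invr_gt0.
  move=> p /KE[n /= nE] /ltW; apply: le_trans.
  by rewrite lef_pV2 ?posrE// ler_nat ltnS leq_bigmax_seq.
pose M := supnorm f.
have M0 : 0 <= M by exact: supnorm_ge0.
have M1 : 0 < M + 1 by rewrite ltr_wpDl.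
(* chosen so that M * (eta / d) <= e / 2; M + 1 avoids dividing by 0 *)
pose eta := d * (e / 2 / (M + 1)).
have eta0 : 0 < eta by rewrite mulr_gt0// divr_gt0.
have seta p : 0 < s p + eta by rewrite ltr_wpDl.
have wP : (fun x : X => of_real k (s (to_stone_cech x) + eta)^-1) \in
    @bounded_continuous R k X.
  apply/bounded_continuousP; split=> [x|].
    have Fx := nbhs_filter x.
    apply: (@continuous_comp X R F
      (fun x => (s (to_stone_cech x) + eta)^-1)); last first.
      exact: continuous_of_real.
    apply: cvgV; first by rewrite gt_eqF.
    apply: cvgD; last exact: cvg_cst.
    by apply: continuous_comp; [exact: to_stone_cech_continuous|exact: cs].
  exists eta^-1 => x; rewrite modulus_of_real gtr0_norm ?invr_gt0//.
  by rewrite lef_pV2 ?posrE// lerDr.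
have hcP i : (fun x => scalar_conj (h i x)) \in @bounded_continuous R k X.
  apply/bounded_continuousP; split=> [x|].
    apply: (@continuous_comp X F F (h i)); first exact: CB_continuous.
    exact: continuous_conj.
  by exists (supnorm (h i)) => x; rewrite modulus_conj supnorm_ub.
pose a i := f * MkCB wP * MkCB (hcP i) * h i.
exists (\sum_(i \in [set` D]) a i).
  exists [set` D], a; split=> //.
  - by move=> i /DJ/set_mem.
  by move=> i _; rewrite principal_idealE; exists (f * MkCB wP * MkCB (hcP i)).
rewrite fsbig_finite//= set_fsetK.
apply: (@le_lt_trans _ _ (e / 2)); last first.
  by rewrite ltr_pdivrMr// ltr_pMr// ltr1n.
apply: supnorm_le => [|x]; first exact: ltW.
pose q := to_stone_cech x : stone_cech R X.
have sumE : (\sum_(i <- enum_fset D) a i : CB R k X) x =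
    f x * of_real k (s q / (s q + eta)).
  rewrite (big_morph (fun g : CB R k X => g x) (fun _ _ => erefl) erefl).
  rewrite mulrC of_realM {1}/s.
  rewrite (big_morph (of_real k) (@of_realD R k) (of_real0 R k)) !mulr_suml.
  apply: eq_bigr => i _.
  have -> : m i q = modulus (h i x) by rewrite /m stone_extE.
  rewrite -mulr_conj.
  have -> : a i x =
      f x * of_real k (s q + eta)^-1 * scalar_conj (h i x) * h i x by [].
  by rewrite [RHS]mulrC -!mulrA; congr (_ * _); rewrite [LHS]mulrC -mulrA.
have -> : (f - \sum_(i <- enum_fset D) a i) x =
    f x * of_real k (eta / (s q + eta)).
  have -> : (f - \sum_(i <- enum_fset D) a i) x =
      f x - (\sum_(i <- enum_fset D) a i : CB R k X) x by [].
  rewrite sumE -[X in X - _]mulr1 -(of_real1 R k) -mulrBr -of_realB.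
  congr (_ * of_real k _).
  rewrite -[X in X - _](@divff _ (s q + eta)) ?gt_eqF//.
  by rewrite -mulrBl addrAC subrr add0r.
have eta_ge0 : 0 <= eta by exact: ltW.
have seta_ge0 : 0 <= s q + eta by exact: ltW.
rewrite modulusM modulus_of_real ger0_norm ?divr_ge0//.
have [Kq|Kq] := pselect (K q).
  apply: (@le_trans _ _ (M * (eta / d))).
    rewrite ler_pM ?modulus_ge0 ?divr_ge0 ?supnorm_ub//.
    rewrite ler_pM2l// lef_pV2 ?posrE// (le_trans (dK _ Kq))//.
    by rewrite lerDl ltW.
  rewrite /eta mulrAC divff ?gt_eqF// mul1r mulrCA.
  by rewrite ler_piMr ?(ltW e20)// ler_pdivrMr// mul1r lerDl.
have fx : modulus (f x) < e / 2.
  by rewrite ltNge; apply/negP => fx; apply: Kq; rewrite /K /= stone_extE.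
rewrite -[leRHS]mulr1 ler_pM ?modulus_ge0 ?divr_ge0 ?(ltW fx)//.
by rewrite ler_pdivrMr// mul1r lerDr.
Qed.

End stone_ext_theory.

(** * The equivalence *)

Theorem theorem3p13 (R : realType) (k : scalar_kind) (X : topologicalType)
    (X_cr : completely_regular_space X) (X_T2 : hausdorff_space X)
    (H : set (CB R k X)) (H_ideal : is_ideal H) (H_closed : closed H)
    (H_nv : non_vanishing H) :
  paracompact (spectrum H) <->
  exists (I : choiceType) (h : I -> CB R k X),
    ideal_sum_direct (fun i => principal_ideal (h i)) /\
    H = closure (ideal_sum [set: I] (fun i => principal_ideal (h i))).
Proof.
pose m (f : CB R k X) p := modulus (stone_ext f p).
have cm f : continuous (m f) by exact: continuous_modulus_stone_ext.
have m0 f p : 0 <= m f p by exact: modulus_ge0.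
have mE f : coz (m f) = coz (stone_ext f) by exact: coz_modulus.
have bT := @stone_cech_compact R X; have T2 := @stone_cech_hausdorff R X.
have [H0 HD HM] := H_ideal.
split=> [|[I [h [hD HE]]]].
  rewrite (_ : spectrum H = \bigcup_(f in H) coz (m f)); last first.
    by apply: eq_bigcupr => f _.
  move=> /(paracompact_disjoint_coz bT T2 cm m0)[c [cc c01 cD cE]].
  have hP C : (fun x : X => of_real k (c C (to_stone_cech x))) \in
      @bounded_continuous R k X.
    apply/bounded_continuousP; split=> [x|].
      apply: (@continuous_comp X R (Defs.scalar R k)
        (fun x => c C (to_stone_cech x))); last exact: continuous_of_real.
      by apply: continuous_comp; [exact: to_stone_cech_continuous|exact: cc].
    by exists 1 => x; have /andP[? ?] := c01 C (to_stone_cech x);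
      rewrite modulus_of_real ger0_norm.
  pose h C := MkCB (hP C).
  have hE C : coz (stone_ext (h C)) = coz (c C).
    rewrite -(@stone_ext_unique R k X (h C) (fun p => of_real k (c C p)))//.
      apply/seteqP; split=> p; rewrite /coz /=.
        by apply: contra_neq => ->; rewrite of_real0.
      by apply: contra_neq; rewrite -{1}(of_real0 R k) => /of_real_inj.
    move=> p; apply: (@continuous_comp _ R (Defs.scalar R k) (c C)).
      exact: cc.
    exact: continuous_of_real.
  exists (set (stone_cech R X)), h; split.
    move=> C; apply/seteqP; split=> [f [Cf sumf]|_ ->]; last first.
      split; first by rewrite principal_idealE; exists 0; rewrite ?mul0r.
      exists set0, (fun=> 0); split=> //; last by rewrite fsbig_set0.
    apply/val_inj/funext => x /=; rewrite -stone_extE.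
    have [hx|hx] := eqVneq (stone_ext (h C) (to_stone_cech x)) 0.
      move: Cf; rewrite principal_idealE => -[a _ <-].
      by rewrite stone_extM hx mulr0.
    apply: ideal_sum_stone_ext_eq0 sumf => D /nesym CD.
    apply/eqP/negPn/negP => hDx.
    have : (coz (c C) `&` coz (c D)) (to_stone_cech x) by rewrite -!hE.
    by rewrite cD.
  apply/seteqP; split=> f.
    move=> Hf; apply: coz_closure_ideal_sum => p fp.
    have : (\bigcup_(f in H) coz (m f)) p by exists f; rewrite ?mE.
    by rewrite -cE => -[C _ Cp]; exists C; rewrite ?hE.
  have HJ : ideal_sum setT (fun C => principal_ideal (h C)) `<=` H.
    apply: ideal_sum_sub => // C _; apply: principal_ideal_sub => //.
    apply: H_closed; apply: (@closureS _ (ideal_sum H principal_ideal)).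
      by apply: ideal_sum_sub => // g Hg; exact: principal_ideal_sub.
    apply: (@coz_closure_ideal_sum _ _ _ _ H id) => p; rewrite hE => Cp.
    have : (\bigcup_C coz (c C)) p by exists C.
    by rewrite cE => -[g Hg]; rewrite mE; exists g.
  by move=> /(closureS HJ)/H_closed.
have hH i : H (h i).
  rewrite HE; apply: subset_closure; exists [set i], h; split=> //.
  - by move=> _ ->; exact: principal_ideal_id.
  - by rewrite fsbig_set1.
rewrite (_ : spectrum H = \bigcup_i coz (m (h i))); last first.
  apply/seteqP; split=> p [].
    move=> f; rewrite HE => /closure_ideal_sum_coz /[apply] -[i _ hip].
    by exists i; rewrite ?mE.
  by move=> i _; rewrite mE; exists (h i).
apply: disjoint_coz_paracompact => // i j ij.
apply/seteqP; split=> // p [/= hip hjp].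
have hij : h i * h j = 0.
  have : [set 0] (h i * h j).
    rewrite -(hD i); split.
      by rewrite principal_idealE mulrC; exists (h j).
    exists [set j], (fun=> h i * h j); split=> //.
    - by move=> _ -> ji; exact: ij.
    - by move=> _ ->; rewrite principal_idealE; exists (h i).
    - by rewrite fsbig_set1.
  by [].
have : stone_ext (h i * h j) p = 0 by rewrite hij stone_ext0.
move/eqP; rewrite stone_extM mulf_eq0.
by move: hip hjp; rewrite !mE /coz /= => /negbTE -> /negbTE ->.
Qed.
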